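(* Let $\mu$ be a quasi-definite complex Borel measure on $\mathbb{T}^D$, let $n_1,\dots,n_{2D}\in\mathbb{C}^{2D}$ be linearly independent (so that the $2D\times2D$ matrix $N$ with rows $n_a^\top$ is invertible), let $z\in(\mathbb{C}^* )^D$ and $q=(q_1,\dots,q_{2D})^\top=N\chi_{[1]}(z)$, i.e. $q_a=L_{n_a}(z)$. Assume the measures $T_ad\mu=(L_{n_a}-q_a)d\mu$, $a=1,\dots,2D$, are quasi-definite. Then the orthogonal Laurent polynomials are expressed in terms of the quasi-tau matrices $H$ and their degree one discrete flows as $$\phi_{[k]}(z)=(-1)^k\,\mathcal N_{k-1}^{+}[\mathbf TH]_{k-1}H_{[k-1]}^{-1}\,\mathcal N_{k-2}^{+}[\mathbf TH]_{k-2}H_{[k-2]}^{-1}\cdots\mathcal N_{0}^{+}[\mathbf TH]_{0}H_{[0]}^{-1},$$ $$\hat\phi_{[k]}(\bar z^{-1})=(-1)^k\,\hat{\mathcal N}_{k-1}^{+}[\mathbf TH]_{k-1}H_{[k-1]}^{-1}\,\hat{\mathcal N}_{k-2}^{+}[\mathbf TH]_{k-2}H_{[k-2]}^{-1}\cdots\hat{\mathcal N}_{0}^{+}[\mathbf TH]_{0}H_{[0]}^{-1}.$$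
   Context: Let $D\ge1$, $z(\theta)=(e^{i\theta_1},\dots,e^{i\theta_D})$. For $\alpha\in\mathbb{Z}^D$ put $|\alpha|=\sum_a|\alpha_a|$, $z^\alpha=\prod_a z_a^{\alpha_a}$, $[k]=\{\alpha:|\alpha|=k\}$ with cardinality $|[k]|$. Multi-indices are ordered by $|\alpha|$ and lexicographically inside each $[k]$; $\chi(z)$ is the semi-infinite column of all monomials in this order, with blocks $\chi_{[k]}$; in particular $\chi_{[1]}(z)=(z_1^{-1},\dots,z_D^{-1},z_D,\dots,z_1)^\top$. Semi-infinite matrices have the corresponding block structure $A_{[k],[l]}$; $A^{[k]}$ denotes truncation to blocks $0,\dots,k-1$. The moment matrix is $G=\oint_{\mathbb{T}^D}\chi(z(\theta))d\mu(\theta)\chi(z(\theta))^\dagger$; $\mu$ is quasi-definite if $\det G^{[k]}\ne0$ for all $k\ge1$, and then uniquely $G=S^{-1}H(\hat S^{-1})^\dagger$ with $S,\hat S$ block lower unitriangular and $H=\operatorname{diag}(H_{[0]},H_{[1]},\dots)$ with invertible blocks (the quasi-tau matrices). $\Phi=S\chi$, $\hat\Phi=\hat S\chi$ have blocks $\phi_{[k]},\hat\phi_{[k]}$. $T_aH_{[k]}$ denotes the corresponding block for the measure $T_ad\mu=(L_{n_a}-q_a)d\mu$. Spectral matrices: $(\Upsilon_b)_{\beta,\gamma}=\delta_{\beta+e_b,\gamma}$, $\Upsilon_b^{-1}=\Upsilon_b^\top$. With $n_a=(n_{a,-1},\dots,n_{a,-D},n_{a,D},\dots,n_{a,1})^\top$,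 $L_{n_a}(z)=\sum_{b=1}^D(n_{a,-b}z_b^{-1}+n_{a,b}z_b)$, $\nu_a=\sum_{b=1}^D(n_{a,-b}\Upsilon_b^{-1}+n_{a,b}\Upsilon_b)$ and $\hat\nu_a=\nu_a^\dagger=\sum_{b=1}^D(\overline{n_{a,-b}}\Upsilon_b+\overline{n_{a,b}}\Upsilon_b^{-1})$. $\mathcal N_k\in\mathbb{C}^{2D|[k]|\times|[k+1]|}$ is the matrix obtained by stacking $(\nu_1)_{[k],[k+1]},\dots,(\nu_{2D})_{[k],[k+1]}$; $\hat{\mathcal N}_k$ is obtained by stacking $(\hat\nu_1)_{[k],[k+1]},\dots,(\hat\nu_{2D})_{[k],[k+1]}$. Their left inverses are $\mathcal N_k^+=(\mathcal N_k^\top\mathcal N_k)^{-1}\mathcal N_k^\top$ and likewise $\hat{\mathcal N}_k^+=(\hat{\mathcal N}_k^\top\hat{\mathcal N}_k)^{-1}\hat{\mathcal N}_k^\top$. $[\mathbf TH]_k\in\mathbb{C}^{2D|[k]|\times|[k]|}$ is the stack of $T_1H_{[k]},\dots,T_{2D}H_{[k]}$. $\bar z^{-1}$ is componentwise.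
   Formalization: The second formula as printed is false; it is proved with the adjoint blocks (T_aH)^† and (H^†)^{-1} in place of T_aH and H^{-1}. Each formula assumes that the matrices N_j^T N_j (resp. the hatted ones), j<k, are invertible, so that the left inverses exist. *)

(* Defs.v *)
(* MathComp-Analysis, with the complex numbers R[i] over an abstract R : realType. *)
From HB Require Import structures.
From mathcomp Require Import all_boot all_order all_algebra.
From mathcomp Require Import all_classical all_reals all_analysis.
From mathcomp Require Import complex zify.

Set Implicit Arguments.
Unset Strict Implicit.
Unset Printing Implicit Defensive.

Import Order.TTheory GRing.Theory Num.Theory.
Import numFieldNormedType.Exports.

Local Open Scope classical_set_scope.
Local Open Scope ring_scope.

(** * Complex measures and their integral *)

(* [R[i]] being a numFieldType, the library's charges with values in
   [\bar R[i]] (finite on measurable sets and sigma-additive) are exactly the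
   complex measures. *)
Notation complex_measure T R := (charge T R[i]).

Section RealPart.
Context d (T : measurableType d) (R : realType).
Variables (mu : complex_measure T R) (p : R[i] -> R).
Hypotheses (pD : {morph p : x y / x + y}) (p0 : p 0 = 0).
Hypothesis p_le : forall x, `|p x|%:C%C <= `|x|.

Let part (A : set T) : \bar R := (p (fine (mu A)))%:E.

Fact real_part_charge0 : part set0 = 0%E.
Proof. by rewrite /part charge0 /= p0. Qed.

Fact real_part_fin_num A : measurable A -> part A \is a fin_num.
Proof. by []. Qed.

Fact real_part_sigma_additive : semi_sigma_additive part.
Proof.
move=> F mF tF mUF.
have finF n : mu (F n) \is a fin_num by exact: fin_num_measure.
have finU : mu (\bigcup_n F n) \is a fin_num by exact: fin_num_measure.
have muF := charge_semi_sigma_additive (s := mu) F mF tF mUF.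
rewrite -(fineK finU) in muF.
apply/fine_cvgP; split.
  by apply: nearW => n; rewrite sumEFin.
apply/cvgrPdist_lt => e e0.
have eC : 0 < e%:C%C :> R[i] by rewrite ltcR.
have muFe : \forall n \near \oo, `|fine (mu (\bigcup_n F n)) -
    fine (\sum_(0 <= i < n) mu (F i))%E| < e%:C%C.
  apply: (muF [set x | `|fine (mu (\bigcup_n F n)) - fine x| < e%:C%C]).
  by apply/nbhs_EFin; apply/nbhs_ballP; exists e%:C%C.
apply: filterS muFe => n /=.
have -> : (\sum_(0 <= i < n) mu (F i))%E =
    (\sum_(0 <= i < n) fine (mu (F i)))%:E.
  by rewrite -sumEFin; apply: eq_bigr => i _; rewrite fineK.
have pN x : p (- x) = - p x by apply/eqP; rewrite -addr_eq0 -pD addNr p0.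
rewrite sumEFin /= -(big_morph p pD p0) -pN -pD => h.
rewrite -ltcR; apply: le_lt_trans (p_le _) _.
exact: h.
Qed.

End RealPart.

Section RealImaginaryParts.
Context d (T : measurableType d) (R : realType).
Variable mu : complex_measure T R.

Definition re_charge (A : set T) : \bar R := (complex.Re (fine (mu A)))%:E.
Definition im_charge (A : set T) : \bar R := (complex.Im (fine (mu A)))%:E.

Let ReD : {morph @complex.Re R : x y / x + y}. Proof. by move=> [? ?] []. Qed.
Let ImD : {morph @complex.Im R : x y / x + y}. Proof. by move=> [? ?] []. Qed.

Let Re_le (x : R[i]) : `|complex.Re x|%:C%C <= `|x|.
Proof. exact: normc_ge_Re. Qed.

Let Im_le (x : R[i]) : `|complex.Im x|%:C%C <= `|x|.
Proof.
case: x => a b; rewrite normc_def /= lecR -sqrtr_sqr ler_wsqrtr //.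
by rewrite lerDr sqr_ge0.
Qed.

HB.instance Definition _ := isCharge.Build _ _ _ re_charge
  (@real_part_charge0 _ _ _ mu _ erefl) (@real_part_fin_num _ _ _ mu _)
  (@real_part_sigma_additive _ _ _ mu _ ReD erefl Re_le).
HB.instance Definition _ := isCharge.Build _ _ _ im_charge
  (@real_part_charge0 _ _ _ mu _ erefl) (@real_part_fin_num _ _ _ mu _)
  (@real_part_sigma_additive _ _ _ mu _ ImD erefl Im_le).

End RealImaginaryParts.

Section Integral.
Context d (T : measurableType d) (R : realType).

(* Integral against a signed measure, through its Jordan decomposition. *)
Definition charge_integral (nu : {charge set T -> \bar R}) (f : T -> R) : R :=
  let P := cid (Hahn_decomposition nu) in
  let N := cid (projT2 P) in
  (\int[jordan_pos (projT2 N)]_x f x) - (\int[jordan_neg (projT2 N)]_x f x).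

Definition complex_integral (mu : complex_measure T R) (f : T -> R[i]) : R[i] :=
  let u x := complex.Re (f x) in
  let v x := complex.Im (f x) in
  Complex
    (charge_integral (re_charge mu) u - charge_integral (im_charge mu) v)
    (charge_integral (re_charge mu) v + charge_integral (im_charge mu) u).

Definition bounded_borel (f : T -> R[i]) : Prop :=
  [/\ measurable_fun setT (fun x => complex.Re (f x)),
      measurable_fun setT (fun x => complex.Im (f x)) &
      exists M, forall x, `|f x| <= M].

(* [has_density nu w mu] is "d nu = w d mu". *)
Definition has_density (nu : complex_measure T R) (w : T -> R[i])
    (mu : complex_measure T R) : Prop :=
  forall f, bounded_borel f ->
    complex_integral nu f = complex_integral mu (fun x => w x * f x).

End Integral.

(** * The unit torus *)

Section Torus.
Variables (R : realType) (D : nat).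

Definition torus : set 'rV[R[i]^o]_D := [set z | forall a, `|z 0 a| = 1].

Fact torus_const1 : (const_mx 1 : 'rV[R[i]^o]_D) \in torus.
Proof. by rewrite inE => a; rewrite mxE normr1. Qed.

HB.instance Definition _ := isPointed.Build (torus : Type)
  (exist (fun z => z \in torus) _ torus_const1).

(* T^D with the Borel sigma-algebra of its subspace topology. *)
Definition torus_borel := g_sigma_algebraType (@open (torus : Type)).

Definition torus_coord (t : torus_borel) : 'I_D -> R[i] := fun a => set_val t 0 a.

End Torus.

(** * Multi-indices *)

Section MultiIndices.
Variable D : nat.

Definition midx := D.-tuple int.

Definition mdeg (al : midx) : nat := (\sum_(a < D) `|tnth al a|)%N.

(* [k], in increasing lexicographic order; the finite functions only serve to
   enumerate the box [-k, k]^D, which contains [k]. *)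
Definition level (k : nat) : seq midx :=
  sort (fun al be : D.-tuplelexi int => (al <= be)%O)
    [seq al <- [seq [tuple ((f a : nat)%:Z - k%:Z) | a < D]
               | f : {ffun 'I_D -> 'I_(k + k).+1}] | mdeg al == k].

Lemma mem_level k al : (al \in level k) = (mdeg al == k).
Proof.
rewrite mem_sort mem_filter; case: eqP => //= degk.
have al_le a : (`|tnth al a| <= k)%N.
  by rewrite -degk /mdeg (bigD1 a) //= leq_addr.
have b a : (absz (tnth al a + k%:Z)%R < (k + k).+1)%N.
  by rewrite ltnS; have := al_le a; lia.
apply/fintype.imageP; exists [ffun a => Ordinal (b a)] => //.
apply: eq_from_tnth => a; rewrite tnth_mktuple ffunE /=.
rewrite gez0_abs ?addrK //; have := al_le a; move: (tnth al a : int) => x; lia.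
Qed.

Lemma uniq_level k : uniq (level k).
Proof.
rewrite sort_uniq filter_uniq // map_inj_uniq ?enum_uniq // => f g fg.
apply/ffunP => a; move/(congr1 (fun t : midx => tnth t a)): fg.
by rewrite !tnth_mktuple => /addIr [] /val_inj.
Qed.

(* |[k]| *)
Definition lsize k := size (level k).

Definition lidx k (i : 'I_(lsize k)) : midx := tnth (in_tuple (level k)) i.

Lemma lsize0 : lsize 0 = 1%N.
Proof.
have := perm_size (uniq_perm (uniq_level 0) (isT : uniq [:: nseq_tuple D 0%Z : midx]) _).
apply => al; rewrite mem_level inE; apply/eqP/eqP => [deg0|->].
  apply: eq_from_tnth => a; rewrite tnth_nseq.
  have : (`|tnth al a| <= 0)%N by rewrite -deg0 /mdeg (bigD1 a) //= leq_addr.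
  by lia.
by rewrite /mdeg big1 // => a _; rewrite tnth_nseq.
Qed.

End MultiIndices.

(** * Block semi-infinite matrices *)

Section BlockMatrices.
Variables (R : realType) (D : nat).

(* A k l is the block A_{[k],[l]}. *)
Definition semi_inf := forall k l, 'M[R[i]]_(lsize D k, lsize D l).

Definition semi_inf_of (A : midx D -> midx D -> R[i]) : semi_inf :=
  fun k l => \matrix_(i, j) A (lidx i) (lidx j).

Definition dagger m n (A : 'M[R[i]]_(m, n)) : 'M[R[i]]_(n, m) :=
  map_mx Num.conj A^T.

(* A^{[k]}: blocks 0, ..., k-1. *)
Definition truncation (A : semi_inf) (k : nat) :=
  \mxblock_(i < k, j < k) A i j.

Definition lower_unitriangular (S : semi_inf) : Prop :=
  (forall k, S k k = 1%:M) /\ (forall k l, (k < l)%N -> S k l = 0).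

Definition semi_inf1 : semi_inf :=
  semi_inf_of (fun al be => (al == be)%:R).

(* Product with a block lower triangular left factor: the sums are finite. *)
Definition mul_lower (S A : semi_inf) : semi_inf :=
  fun k l => \sum_(j < k.+1) S k j *m A j l.

(* G = S^-1 H (S'^-1)^dagger, where H is given by its diagonal blocks. *)
Definition gauss_factorization (G S : semi_inf)
    (H : forall k, 'M[R[i]]_(lsize D k)) (S' : semi_inf) : Prop :=
  [/\ lower_unitriangular S, lower_unitriangular S',
      forall k, H k \in unitmx
    & exists Si Si' : semi_inf,
      [/\ lower_unitriangular Si, lower_unitriangular Si',
          forall k l, mul_lower S Si k l = semi_inf1 k l,
          forall k l, mul_lower S' Si' k l = semi_inf1 k l
        & forall k l, G k l =
            \sum_(j < (minn k l).+1) Si k j *m H j *m dagger (Si' l j)]].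

(* chi_{[k]}(z) *)
Definition monomial (z : 'I_D -> R[i]) (al : midx D) : R[i] :=
  \prod_(a < D) z a ^ tnth al a.

Definition chi (z : 'I_D -> R[i]) (k : nat) : 'cV[R[i]]_(lsize D k) :=
  \col_i monomial z (lidx i).

Definition moment_matrix (mu : complex_measure (torus_borel R D) R) : semi_inf :=
  semi_inf_of (fun al be => complex_integral mu (fun t =>
    monomial (torus_coord t) al * (monomial (torus_coord t) be)^*%R)).

Definition quasi_definite (mu : complex_measure (torus_borel R D) R) : Prop :=
  forall k, (0 < k)%N -> \det (truncation (moment_matrix mu) k) != 0.

(* The block phi_{[k]}(z) of S chi(z). *)
Definition laurent_poly (S : semi_inf) (k : nat) (z : 'I_D -> R[i]) :
    'cV[R[i]]_(lsize D k) :=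
  \sum_(j < k.+1) S k j *m chi z j.

(** ** Spectral matrices *)

(* beta + e_b = gamma *)
Definition shifted (b : 'I_D) (be ga : midx D) : bool :=
  [forall c, tnth ga c == tnth be c + (c == b)%:R].

Definition upsilon (b : 'I_D) (be ga : midx D) : R[i] := (shifted b be ga)%:R.

Definition upsilonV (b : 'I_D) (be ga : midx D) : R[i] := upsilon b ga be.

(* A coefficient vector n is ordered as (n_{-1}, ..., n_{-D}, n_D, ..., n_1). *)
Definition coef_neg (n : 'rV[R[i]]_(D + D)) (b : 'I_D) := n 0 (lshift D b).
Definition coef_pos (n : 'rV[R[i]]_(D + D)) (b : 'I_D) :=
  n 0 (rshift D (rev_ord b)).

(* L_n(z) *)
Definition laurent1 (n : 'rV[R[i]]_(D + D)) (z : 'I_D -> R[i]) : R[i] :=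
  \sum_(b < D) (coef_neg n b * (z b)^-1 + coef_pos n b * z b).

Definition nu (n : 'rV[R[i]]_(D + D)) : semi_inf :=
  semi_inf_of (fun be ga =>
    \sum_(b < D) (coef_neg n b * upsilonV b be ga
                  + coef_pos n b * upsilon b be ga)).

Definition nu_hat (n : 'rV[R[i]]_(D + D)) : semi_inf :=
  fun k l => dagger (nu n l k).

(** ** Stacked matrices *)

Variable N : 'M[R[i]]_(D + D).

Definition Nstack (k : nat) := \mxcol_(a < D + D) nu (row a N) k k.+1.
Definition Nstack_hat (k : nat) := \mxcol_(a < D + D) nu_hat (row a N) k k.+1.

Definition THstack (TH : 'I_(D + D) -> forall k, 'M[R[i]]_(lsize D k)) (k : nat) :=
  \mxcol_(a < D + D) TH a k.

(* Taking adjoints in G = S^-1 H (S'^-1)^dagger gives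
   G^dagger = S'^-1 H^dagger (S^-1)^dagger, and (T_a G)^dagger is
   G^dagger multiplied by nu_hat_a - conj(q_a); hence the blocks H^dagger and
   (T_a H)^dagger are for the polynomials S' chi what H and T_a H are for
   S chi, and the two families differ unless these blocks are Hermitian. *)
Definition dagger_blocks (H : forall k, 'M[R[i]]_(lsize D k)) :
    forall k, 'M[R[i]]_(lsize D k) :=
  fun k => dagger (H k).

(* (A^T A)^-1 A^T; [invmx] is meaningful only when the plain transpose Gram
   matrix A^T A is invertible, which over the complex numbers is more than
   injectivity of A. *)
Definition gram m n (A : 'M[R[i]]_(m, n)) : 'M[R[i]]_n := A^T *m A.
Definition plus_inverse m n (A : 'M[R[i]]_(m, n)) : 'M[R[i]]_(n, m) :=
  invmx (gram A) *m A^T.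

(* F_{k-1} F_{k-2} ... F_0 *)
Fixpoint descending_product (F : forall k, 'M[R[i]]_(lsize D k.+1, lsize D k))
    (k : nat) : 'M[R[i]]_(lsize D k, lsize D 0) :=
  if k is j.+1 then F j *m descending_product F j else 1%:M.

(* The same product as a column, [0] having a single element. *)
Definition product_column (F : forall k, 'M[R[i]]_(lsize D k.+1, lsize D k))
    (k : nat) : 'cV[R[i]]_(lsize D k) :=
  castmx (erefl _, lsize0 D) (descending_product F k).

End BlockMatrices.

(* Main.v *)
(* Write K_a = nu_a - q_a.  Multiplying dmu by L_{n_a} - q_a multiplies the moment
   matrix G on the left by K_a, so the Gauss factorizations of G and T_a G show
   that the connection matrix S_a K_a S^-1 equals (T_a H) U_a H^-1 with U_a block
   upper unitriangular.  Being also block lower Hessenberg, it has only the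
   diagonal blocks (T_a H)_[k] H_[k]^-1 and the superdiagonal blocks
   (nu_a)_[k],[k+1].  It annihilates Phi(z) because K_a chi(z) = 0, hence
     (nu_a)_[k],[k+1] phi_[k+1](z) = - T_a H_[k] H_[k]^-1 phi_[k](z).
   Stacking over a and applying the left inverse of N_k gives a recursion from
   phi_[0] = 1.  The second formula is the first one for G^dagger: by the Toeplitz
   property of moments, (T_a G)^dagger = (nu_a^dagger - conj q_a) G^dagger, and
   nu_a^dagger is the spectral matrix of a Laurent polynomial whose value at
   conj(z)^-1 is conj q_a. *)

Require Import Defs.
From HB Require Import structures.
From mathcomp Require Import all_boot all_order all_algebra.
From mathcomp Require Import all_classical all_reals all_analysis measurable_realfun.
From mathcomp Require Import complex zify ring.

Set Implicit Arguments.
Unset Strict Implicit.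
Unset Printing Implicit Defensive.

Import Order.TTheory GRing.Theory Num.Theory.
Import numFieldNormedType.Exports.

Local Open Scope classical_set_scope.
Local Open Scope ring_scope.

(** * Block linear algebra *)

Section Dagger.
Variable R : realType.

Lemma daggerK m n : cancel (@dagger R m n) (@dagger R n m).
Proof. by move=> A; apply/matrixP => i j; rewrite !mxE conjCK. Qed.

Lemma dagger0 m n : dagger (0 : 'M[R[i]]_(m, n)) = 0.
Proof. by rewrite /dagger trmx0 map_mx0. Qed.

Lemma dagger1 n : dagger (1%:M : 'M[R[i]]_n) = 1%:M.
Proof. by rewrite /dagger trmx1 map_mx1. Qed.

Lemma dagger_sum I (r : seq I) (P : pred I) m n (F : I -> 'M[R[i]]_(m, n)) :
  dagger (\sum_(i <- r | P i) F i) = \sum_(i <- r | P i) dagger (F i).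
Proof. by rewrite /dagger linear_sum map_mx_sum. Qed.

Lemma dagger_mul m n p (A : 'M[R[i]]_(m, n)) (B : 'M[R[i]]_(n, p)) :
  dagger (A *m B) = dagger B *m dagger A.
Proof. by rewrite /dagger trmx_mul map_mxM. Qed.

Lemma unitmx_dagger n (A : 'M[R[i]]_n) : (dagger A \in unitmx) = (A \in unitmx).
Proof. by rewrite /dagger map_unitmx unitmx_tr. Qed.

End Dagger.

Section TruncatedProduct.
Variable F : pzRingType.
Implicit Types d e f g : nat -> nat.

(* Products of semi-infinite block matrices whose inner sum runs over the first
   [n] blocks only; unlike the infinite products they are always associative. *)
Definition tmul d e f n (A : forall k l, 'M[F]_(d k, e l))
    (B : forall k l, 'M[F]_(e k, f l)) k l : 'M[F]_(d k, f l) :=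
  \sum_(j < n) A k j *m B j l.

Lemma tmulA d e f g m n (A : forall k l, 'M[F]_(d k, e l))
    (B : forall k l, 'M[F]_(e k, f l)) (C : forall k l, 'M[F]_(f k, g l)) k l :
  tmul n (tmul m A B) C k l = tmul m A (tmul n B C) k l.
Proof.
rewrite /tmul; under eq_bigr => j _ do rewrite mulmx_suml.
rewrite exchange_big /=; apply: eq_bigr => i _.
by rewrite mulmx_sumr; apply: eq_bigr => j _; rewrite mulmxA.
Qed.

Lemma eq_tmul d e f n (A A' : forall k l, 'M[F]_(d k, e l))
    (B B' : forall k l, 'M[F]_(e k, f l)) k l :
  (forall j, (j < n)%N -> A k j = A' k j) ->
  (forall j, (j < n)%N -> B j l = B' j l) ->
  tmul n A B k l = tmul n A' B' k l.
Proof. by move=> AA BB; apply: eq_bigr => j _; rewrite AA ?BB. Qed.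

(** Triangular and banded factors kill all summands from some index on; this is how sums of
    different lengths are brought to a common cut-off. *)
Lemma tmul_widen d e f m n (A : forall k l, 'M[F]_(d k, e l))
    (B : forall k l, 'M[F]_(e k, f l)) k l :
  (m <= n)%N -> (forall j, (m <= j)%N -> A k j *m B j l = 0) ->
  tmul n A B k l = tmul m A B k l.
Proof.
move=> mn AB0; rewrite /tmul -!(big_mkord xpredT (fun j => A k j *m B j l)).
rewrite (big_cat_nat (n := m)) //= [X in _ + X]big_nat_cond.
by rewrite [X in _ + X]big1 ?addr0 // => j /andP[/andP[mj _] _]; apply: AB0.
Qed.

Lemma tmul_single d e f n (A : forall k l, 'M[F]_(d k, e l))
    (B : forall k l, 'M[F]_(e k, f l)) k l i :
  (i < n)%N -> (forall j, j != i -> A k j *m B j l = 0) ->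
  tmul n A B k l = A k i *m B i l.
Proof.
move=> iltn AB0; rewrite /tmul (bigD1 (Ordinal iltn)) //= big1 ?addr0 // => j ji.
exact: AB0.
Qed.

End TruncatedProduct.

(** * Gauss factorizations and the connection matrix *)

Section Darboux.
Variables (R : realType) (D : nat).
Implicit Types (A S G K : semi_inf R D).
Local Notation d := (lsize D).

Lemma lidx_inj k : injective (@lidx D k).
Proof. by apply/tuple_uniqP; apply: uniq_level. Qed.

Lemma semi_inf1E k : semi_inf1 R D k k = 1%:M.
Proof. by apply/matrixP => i j; rewrite !mxE (inj_eq (@lidx_inj k)). Qed.

Lemma mdeg_lidx k (i : 'I_(d k)) : mdeg (lidx i) = k.
Proof. by apply/eqP; rewrite -mem_level /lidx mem_tnth. Qed.

Lemma semi_inf1_neq k l : k != l -> semi_inf1 R D k l = 0.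
Proof.
move=> kl; apply/matrixP => i j; rewrite !mxE; case: eqP => // eij.
by rewrite -(mdeg_lidx i) eij mdeg_lidx eqxx in kl.
Qed.

Lemma mul_lowerE n S f (A : forall k l, 'M[R[i]]_(d k, f l)) k l :
  lower_unitriangular S -> (k < n)%N ->
  tmul n S A k l = \sum_(j < k.+1) S k j *m A j l.
Proof.
by move=> [_ S0] kn; apply: tmul_widen => // j kj; rewrite S0 ?mul0mx.
Qed.

Lemma tmul1l n f (A : forall k l, 'M[R[i]]_(d k, f l)) k l :
  (k < n)%N -> tmul n (semi_inf1 R D) A k l = A k l.
Proof.
move=> kn; rewrite (tmul_single (i := k)) ?semi_inf1E ?mul1mx // => j jk.
by rewrite semi_inf1_neq 1?eq_sym // mul0mx.
Qed.

Lemma tmul1r n f (A : forall k l, 'M[R[i]]_(f k, d l)) k l :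
  (l < n)%N -> tmul n A (semi_inf1 R D) k l = A k l.
Proof.
move=> kn; rewrite (tmul_single (i := l)) ?semi_inf1E ?mulmx1 // => j jk.
by rewrite semi_inf1_neq // mulmx0.
Qed.

(** Induction on the row: the unit diagonal isolates [A k l], and the rest of the sum involves
    earlier rows, which already agree. *)
Lemma lower_unitriangular_cancel n S f (A B : forall k l, 'M[R[i]]_(d k, f l)) l :
  lower_unitriangular S ->
  (forall k, (k < n)%N -> tmul n S A k l = tmul n S B k l) ->
  forall k, (k < n)%N -> A k l = B k l.
Proof.
move=> Slow SAB; elim/ltn_ind => k IH kn.
have := SAB k kn; rewrite !mul_lowerE // !big_ord_recr /= Slow.1 !mul1mx.
rewrite (eq_bigr (fun j : 'I_k => S k j *m B j l)) => [/addrI //|j _].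
by rewrite IH // (ltn_trans _ kn).
Qed.

Lemma mul_lower_inv_right n S Si f (A : forall k l, 'M[R[i]]_(d k, f l)) k l :
  lower_unitriangular S ->
  (forall k l, mul_lower S Si k l = semi_inf1 R D k l) ->
  (k < n)%N -> tmul n S (tmul n Si A) k l = A k l.
Proof.
move=> Slow SSi kn; rewrite -tmulA -[RHS](tmul1l _ _ kn).
by apply: eq_tmul => // j _; rewrite mul_lowerE // -SSi.
Qed.

(** The factorization supplies only [S Si = 1]; the other order follows by cancelling [S] in
    [S (Si (S A)) = S A]. *)
Lemma mul_lower_inv_left n S Si f (A : forall k l, 'M[R[i]]_(d k, f l)) k l :
  lower_unitriangular S ->
  (forall k l, mul_lower S Si k l = semi_inf1 R D k l) ->
  (k < n)%N -> tmul n Si (tmul n S A) k l = A k l.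
Proof.
move=> Slow SSi; apply: (lower_unitriangular_cancel Slow) => {}k kn.
by rewrite (mul_lower_inv_right (Si := Si)).
Qed.

(** Triangularity makes the truncated products exact within the first [n] blocks, so the right
    factor of [G] cancels against the adjoint of [S'], as in G S'^dagger = S^-1 H. *)
Lemma gauss_right G (H : forall k, 'M[R[i]]_(d k)) S' (Si Si' : semi_inf R D) n i m :
  lower_unitriangular S' -> lower_unitriangular Si -> lower_unitriangular Si' ->
  (forall k l, mul_lower S' Si' k l = semi_inf1 R D k l) ->
  (forall k l, G k l =
            \sum_(j < (minn k l).+1) Si k j *m H j *m dagger (Si' l j)) ->
  (i < n)%N -> (m < n)%N ->
  tmul n G (fun k l => dagger (S' l k)) i m = Si i m *m H m.
Proof.
move=> S'l Sil Si'l S'Si' GE iltn mn.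
pose SiH : semi_inf R D := fun k l => Si k l *m H l.
have -> : tmul n G (fun k l => dagger (S' l k)) i m =
   tmul n (tmul n SiH (fun k l => dagger (Si' l k))) (fun k l => dagger (S' l k)) i m.
  apply: eq_tmul => // l ln; rewrite GE.
  rewrite (tmul_widen (m := (minn i l).+1)) // ?gtn_min ?iltn //.
  move=> j; rewrite /SiH gtn_min => /orP[ij|lj].
    by rewrite Sil.2 // !mul0mx.
  by rewrite Si'l.2 // dagger0 mulmx0.
rewrite tmulA; transitivity (tmul n SiH (semi_inf1 R D) i m); last by rewrite tmul1r.
apply: eq_tmul => // j jn.
(* The identity is written as its own adjoint so that the adjoint of [S' Si' = 1] applies. *)
have -> : semi_inf1 R D j m = dagger (semi_inf1 R D m j).
  case: (eqVneq j m) => [->|jm]; first by rewrite semi_inf1E dagger1.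
  by rewrite !semi_inf1_neq ?dagger0 // eq_sym.
rewrite -S'Si' /mul_lower -(mul_lowerE (n := n)) // dagger_sum.
by apply: eq_bigr => l _; rewrite dagger_mul.
Qed.

(** The counterpart S G = H (S'^-1)^dagger: the right side is rewritten as S (S^-1 H
    (S'^-1)^dagger), whose inner product is [G]. *)
Lemma gauss_left G (H : forall k, 'M[R[i]]_(d k)) S (Si Si' : semi_inf R D) n k l :
  lower_unitriangular S -> lower_unitriangular Si -> lower_unitriangular Si' ->
  (forall k l, mul_lower S Si k l = semi_inf1 R D k l) ->
  (forall k l, G k l =
            \sum_(j < (minn k l).+1) Si k j *m H j *m dagger (Si' l j)) ->
  (k < n)%N ->
  tmul n S G k l = H k *m dagger (Si' l k).
Proof.
move=> Sl Sil Si'l SSi GE kn.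
pose HSi' : semi_inf R D := fun k l => H k *m dagger (Si' l k).
rewrite -/(HSi' k l) -(mul_lower_inv_right HSi' l Sl SSi kn).
apply: eq_tmul => // i iltn; rewrite GE.
rewrite (tmul_widen (m := (minn i l).+1)) ?gtn_min ?iltn //; last first.
  move=> j; rewrite /HSi' gtn_min => /orP[ij|lj].
    by rewrite Sil.2 // mul0mx.
  by rewrite Si'l.2 // dagger0 !mulmx0.
by apply: eq_bigr => j _; rewrite mulmxA.
Qed.

(* [TS K S^-1 = TH (TS'^-1)^dagger S'^dagger H^-1] is both block lower
   Hessenberg and block upper triangular, hence has only two block diagonals,
   and it annihilates [S X] since [K X = 0]. *)
Lemma darboux_connection K G TG S S' TS TS' H TH (X : forall k, 'cV[R[i]]_(d k)) k :
  gauss_factorization G S H S' -> gauss_factorization TG TS TH TS' ->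
  (forall i j, (i.+1 < j)%N -> K i j = 0) ->
  (forall i l, TG i l = \sum_(j < i.+2) K i j *m G j l) ->
  (forall i, \sum_(j < i.+2) K i j *m X j = 0) ->
  K k k.+1 *m (\sum_(j < k.+2) S k.+1 j *m X j) =
    - (TH k *m invmx (H k) *m (\sum_(j < k.+1) S k j *m X j)).
Proof.
move=> [Sl S'l Hu [Si [Si' [Sil Si'l SSi S'Si' GE]]]].
move=> [TSl TS'l THu [TSi [TSi' [TSil TSi'l TSSi TS'Si' TGE]]]] K0 TGK KX.
(* [tmul] takes doubly indexed families; the column index of [XX] is a dummy. *)
pose XX : forall k l : nat, 'M[R[i]]_(d k, (fun=> 1%N) l) := fun k _ => X k.
(* Row [k] of [TS] lives in the first [k.+1] blocks, and the corresponding rows of [K] in the first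
   [k.+2], so row [k] of [Om] is that of TS K S^-1. *)
pose n := k.+2; pose Phi := tmul n S XX.
pose Om := tmul k.+1 TS (tmul n K Si).
have PhiE m : (m < n)%N -> Phi m 0%N = \sum_(j < m.+1) S m j *m X j.
  by move=> mn; rewrite /Phi mul_lowerE.
(* TS K S^-1 S X = TS K X = 0. *)
have OmPhi : tmul n Om Phi k 0%N = 0.
  rewrite /Om tmulA /tmul big1 // => i _.
  rewrite -/(tmul n (tmul n K Si) Phi i 0%N) tmulA.
  suff -> : tmul n K (tmul n Si Phi) i 0%N = 0 by rewrite mulmx0.
  have ik : (i.+1 < n)%N by rewrite ltnS.
  transitivity (tmul n K XX i 0%N).
    by apply: eq_tmul => // j jn; rewrite (mul_lower_inv_left (S := S)).
  rewrite (tmul_widen (m := i.+2)) //; first exact: KX.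
  by move=> j ij; rewrite K0 ?mul0mx.
pose Sd : semi_inf R D := fun k l => dagger (S' l k).
pose THS : semi_inf R D := fun k l => TH k *m dagger (TSi' l k).
(* TS K G S'^dagger = TS TG S'^dagger = TH (TS'^-1)^dagger S'^dagger, a product of upper triangular
   factors. *)
have OmH m : (m <= k)%N -> Om k m *m H m = tmul n THS Sd k m.
  move=> mk; have mn : (m < n)%N by rewrite ltnW.
  transitivity (tmul k.+1 TS (tmul n TG Sd) k m).
    rewrite /Om /tmul mulmx_suml; apply: eq_bigr => i _; rewrite -mulmxA.
    congr (_ *m _); rewrite mulmx_suml.
    transitivity (tmul n K (tmul n G Sd) i m).
      apply: eq_bigr => j _; rewrite -mulmxA; congr (_ *m _).
      by rewrite (gauss_right (H := H) (Si := Si) (Si' := Si')).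
    rewrite -tmulA; apply: eq_tmul => // j jn; rewrite TGK.
    apply: tmul_widen; first by rewrite !ltnS -ltnS.
    by move=> l il; rewrite K0 ?mul0mx.
  rewrite -tmulA; apply: eq_tmul => // j _.
  by rewrite (gauss_left (H := TH) (Si := TSi) (Si' := TSi')).
(* The first factor vanishes for [j < k] and the second for [m < j]; together these cover every
   [j]. *)
have Om0 m : (m < k)%N -> Om k m = 0.
  move=> mk; rewrite -[LHS](mulmxK (Hu m)) OmH 1?ltnW //.
  rewrite /tmul big1 ?mul0mx // => j _; case: (ltnP j k) => [jk|kj].
    by rewrite /THS TSi'l.2 // dagger0 mulmx0 mul0mx.
  by rewrite /Sd S'l.2 ?dagger0 ?mulmx0 // (leq_trans mk).
have Omk : Om k k = TH k *m invmx (H k).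
  rewrite -[LHS](mulmxK (Hu k)) OmH //; congr (_ *m _).
  rewrite (tmul_single (i := k)) // /THS /Sd ?TSi'l.1 ?S'l.1 ?dagger1 ?mulmx1 // => j.
  rewrite neq_ltn => /orP[jk|kj]; first by rewrite TSi'l.2 // dagger0 mulmx0 mul0mx.
  by rewrite S'l.2 // dagger0 mulmx0.
(* Here the defining product is used: [K] has nothing above its first superdiagonal, and the unit
   diagonals of [TS] and [Si] leave that superdiagonal unchanged. *)
have Omk1 : Om k k.+1 = K k k.+1.
  have KSi i : (i <= k)%N -> tmul n K Si i k.+1 = K i k.+1.
    move=> ik; rewrite (tmul_single (i := k.+1)) ?Sil.1 ?mulmx1 // => j.
    rewrite neq_ltn => /orP[jk|kj]; first by rewrite Sil.2 ?mulmx0.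
    by rewrite K0 ?mul0mx // (leq_trans _ kj).
  rewrite /Om (tmul_single (i := k)) ?TSl.1 ?mul1mx ?KSi // => j.
  rewrite neq_ltn => /orP[jk|kj]; last by rewrite TSl.2 ?mul0mx.
  by rewrite KSi ?(ltnW jk) // K0 ?mulmx0.
rewrite -!PhiE // -Omk -Omk1; move: OmPhi.
(* Only the blocks [k] and [k.+1] of row [k] of [Om] survive in [OmPhi]. *)
rewrite /tmul !big_ord_recr /= big1 ?add0r => [|j _]; last by rewrite /= Om0 ?mul0mx.
by rewrite addrC => /eqP; rewrite addr_eq0 => /eqP.
Qed.

Lemma gauss_factorization_dagger G S S' H :
  gauss_factorization G S H S' ->
  gauss_factorization (fun k l => dagger (G l k)) S' (dagger_blocks H) S.
Proof.
move=> [Sl S'l Hu [Si [Si' [Sil Si'l SSi S'Si' GE]]]]; split=> //.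
  by move=> k; rewrite unitmx_dagger.
exists Si', Si; split=> // k l; rewrite GE dagger_sum minnC.
by apply: eq_bigr => j _; rewrite !dagger_mul daggerK mulmxA.
Qed.

End Darboux.

(** * Spectral matrices *)

Section Shifts.
Variables (R : realType) (D : nat).
Implicit Types (al be ga : midx D) (b : 'I_D) (n : 'rV[R[i]]_(D + D)).

Definition midx_shift b (s : int) al : midx D :=
  [tuple tnth al c + (if c == b then s else 0) | c < D].

Lemma midx_shiftK b s : cancel (midx_shift b s) (midx_shift b (- s)).
Proof.
move=> al; apply: eq_from_tnth => c; rewrite !tnth_mktuple.
by case: eqP => _; rewrite ?addrK ?addr0.
Qed.

Lemma shiftedE b be ga : shifted b be ga = (ga == midx_shift b 1 be).
Proof.
apply/forallP/eqP => [h|-> c].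
  by apply: eq_from_tnth => c; rewrite tnth_mktuple (eqP (h c)); case: (c == b).
by rewrite tnth_mktuple; case: (c == b).
Qed.

Lemma shiftedVE b be ga : shifted b be ga = (be == midx_shift b (-1) ga).
Proof.
rewrite shiftedE; apply/eqP/eqP => ->; first by rewrite midx_shiftK.
exact/esym/(midx_shiftK b (-1)).
Qed.

(** A unit shift thus raises the degree by at most one, which bounds the band of the spectral
    matrices. *)
Lemma mdeg_shift b s al : (mdeg (midx_shift b s al) <= mdeg al + `|s|)%N.
Proof.
rewrite /mdeg (bigD1 b) //= [X in (_ <= X + _)%N](bigD1 b) //= tnth_mktuple eqxx.
rewrite (eq_bigr (fun c => `|tnth al c|%N)) => [|c /negPf cb]; last first.
  by rewrite tnth_mktuple cb addr0.
move: (\sum_(i < D | _) _)%N (tnth al b : int) => m x; lia.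
Qed.

Lemma monomial_shift (w : 'I_D -> R[i]) b s al : w b != 0 ->
  monomial w (midx_shift b s al) = w b ^ s * monomial w al.
Proof.
move=> wb; rewrite /monomial (bigD1 b) //= [in RHS](bigD1 b) //= tnth_mktuple eqxx.
rewrite expfzDr // mulrA [w b ^ s * _]mulrC; congr (_ * _).
by apply: eq_bigr => c /negPf cb; rewrite tnth_mktuple cb addr0.
Qed.

(** Each multi-index of degree below [m] occurs exactly once in the levels before [m]; this turns
    block sums into sums over multi-indices. *)
Lemma sum_levels (m : nat) (F : midx D -> R[i]) al : (mdeg al < m)%N ->
  \sum_(j < m) \sum_(s < lsize D j) (lidx s == al)%:R * F (lidx s) = F al.
Proof.
move=> alm; rewrite (bigD1 (Ordinal alm)) //= [X in _ + X]big1 ?addr0; last first.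
  move=> j jal; apply: big1 => s _; case: eqP => [sal|_]; last by rewrite mul0r.
  by move: jal; rewrite -val_eqE /= -sal mdeg_lidx eqxx.
have /seq_tnthP[s sal] : al \in level D (mdeg al) by rewrite mem_level.
rewrite (bigD1 s) //= big1 ?addr0 => [|i /negPf is_]; rewrite /lidx -/(lidx _).
  by rewrite /lidx -sal eqxx mul1r.
by rewrite [X in _ == X]sal (inj_eq (@lidx_inj D _)) is_ mul0r.
Qed.

(** The action of nu_n - q on a vector [F] indexed by multi-indices, written without blocks. *)
Definition three_term n (q : R[i]) (F : midx D -> R[i]) al : R[i] :=
  \sum_(b < D) (coef_neg n b * F (midx_shift b (-1) al)
                + coef_pos n b * F (midx_shift b 1 al)) - q * F al.

Definition spectral n (q : R[i]) : semi_inf R D :=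
  fun k l => nu n k l - q *: semi_inf1 R D k l.

(** The neighbours of a multi-index of degree [k] have degree at most [k.+1], so the first [k.+2]
    blocks contain them all. *)
Lemma spectral_three_term n q (F : midx D -> R[i]) k (r : 'I_(lsize D k)) :
  \sum_(j < k.+2) \sum_(s < lsize D j) spectral n q k j r s * F (lidx s) =
  three_term n q F (lidx r).
Proof.
set al := lidx r.
have dal : mdeg al = k by rewrite mdeg_lidx.
have dsh b (s : int) : `|s|%N = 1%N -> (mdeg (midx_shift b s al) < k.+2)%N.
  by move=> s1; rewrite ltnS -addn1 -dal -s1 mdeg_shift.
have E : forall j (s : 'I_(lsize D j)), spectral n q k j r s * F (lidx s) =
   \sum_(b < D) (coef_neg n b * ((lidx s == midx_shift b (-1) al)%:R * F (lidx s))
    + coef_pos n b * ((lidx s == midx_shift b 1 al)%:R * F (lidx s)))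
   - q * ((lidx s == al)%:R * F (lidx s)).
  move=> j s; rewrite !mxE mulrBl mulr_suml -!mulrA [al == _]eq_sym; congr (_ - _).
  apply: eq_bigr => b _; rewrite mulrDl -!mulrA /upsilonV /upsilon.
  by rewrite shiftedVE shiftedE.
under eq_bigr => j _ do (under eq_bigr => s _ do rewrite E; rewrite sumrB).
rewrite sumrB /three_term; congr (_ - _); last first.
  under eq_bigr => j _ do rewrite -mulr_sumr.
  by rewrite -mulr_sumr sum_levels // dal.
under eq_bigr => j _ do rewrite exchange_big /=.
rewrite exchange_big /=; apply: eq_bigr => b _.
under eq_bigr => j _ do rewrite big_split /= -!mulr_sumr.
by rewrite big_split /= -!mulr_sumr !sum_levels ?dsh.
Qed.

Lemma spectral_mul n q (M TM : midx D -> midx D -> R[i]) k l :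
  (forall al be, TM al be = three_term n q (M^~ be) al) ->
  semi_inf_of TM k l = \sum_(j < k.+2) spectral n q k j *m semi_inf_of M j l.
Proof.
move=> TME; apply/matrixP => r t; rewrite mxE TME -spectral_three_term summxE.
apply: eq_bigr => j _; rewrite [RHS]mxE; apply: eq_bigr => s _.
by rewrite [semi_inf_of _ _ _ _ _]mxE.
Qed.

(** The monomials form a joint eigenvector of the shifts: Upsilon_b and its inverse act as w_b and
    w_b^-1, hence nu_n acts as L_n(w) = q. *)
Lemma spectral_chi n q (w : 'I_D -> R[i]) k :
  (forall b, w b != 0) -> q = laurent1 n w ->
  \sum_(j < k.+2) spectral n q k j *m chi w j = 0.
Proof.
move=> w0 qE; apply/matrixP => r t; rewrite summxE [RHS]mxE.
transitivity (three_term n q (monomial w) (lidx r)).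
  rewrite -spectral_three_term; apply: eq_bigr => j _; rewrite [LHS]mxE.
  by apply: eq_bigr => s _; rewrite [chi _ _ _ _]mxE.
rewrite /three_term qE /laurent1 mulr_suml -sumrB big1 // => b _.
by rewrite !monomial_shift // mulrDl -!mulrA subrr.
Qed.

Lemma spectral_far n q k l : (k.+1 < l)%N -> spectral n q k l = 0.
Proof.
move=> kl; rewrite /spectral semi_inf1_neq ?scaler0 ?subr0; last first.
  by rewrite ltn_eqF // ltnW.
apply/matrixP => r s; rewrite !mxE.
have far b (e : int) : `|e|%N = 1%N -> (lidx s == midx_shift b e (lidx r)) = false.
  move=> e1; apply/eqP => /(congr1 (@mdeg D)) /eqP; rewrite mdeg_lidx.
  apply/negP; rewrite gtn_eqF // (leq_ltn_trans (mdeg_shift b e _)) //.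
  by rewrite mdeg_lidx e1 addn1.
by rewrite big1 // => b _; rewrite /upsilonV /upsilon shiftedVE shiftedE !far // !mulr0 addr0.
Qed.

(** The identity has only diagonal blocks, so the superdiagonal block of nu_n - q is that of nu_n
    and [q] disappears from the relation. *)
Lemma nu_connection n q (M TM : midx D -> midx D -> R[i]) S S' TS TS' H TH w k :
  (forall al be, TM al be = three_term n q (M^~ be) al) ->
  (forall b, w b != 0) -> q = laurent1 n w ->
  gauss_factorization (semi_inf_of M) S H S' ->
  gauss_factorization (semi_inf_of TM) TS TH TS' ->
  nu n k k.+1 *m laurent_poly S k.+1 w =
    - (TH k *m invmx (H k) *m laurent_poly S k w).
Proof.
move=> TME w0 qE GE TGE.
rewrite /laurent_poly -(darboux_connection (K := spectral n q) _ GE TGE).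
- by rewrite /spectral semi_inf1_neq ?scaler0 ?subr0 // ltn_eqF.
- exact: spectral_far.
- by move=> i l; apply: spectral_mul.
- by move=> i; apply: spectral_chi.
Qed.

(* Coefficient vectors being ordered as (n_{-1}, ..., n_{-D}, n_D, ..., n_1),
   reversal exchanges the coefficients of z_b and z_b^-1. *)
Definition conj_rev n : 'rV[R[i]]_(D + D) := \row_i (n 0 (rev_ord i))^*.

Lemma coef_neg_conj_rev n b : coef_neg (conj_rev n) b = (coef_pos n b)^*.
Proof.
rewrite /coef_neg /coef_pos mxE; congr (n 0 _)^*; apply: val_inj => /=.
by rewrite addnBA.
Qed.

Lemma coef_pos_conj_rev n b : coef_pos (conj_rev n) b = (coef_neg n b)^*.
Proof.
rewrite /coef_neg /coef_pos mxE; congr (n 0 _)^*; apply: val_inj => /=.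
have := ltn_ord b; lia.
Qed.

(** Taking adjoints swaps Upsilon_b with its inverse and conjugates the coefficients; the second
    family thereby falls under [nu_connection]. *)
Lemma nu_hatE n k l : nu_hat n k l = nu (conj_rev n) k l.
Proof.
apply/matrixP => r s; rewrite !mxE rmorph_sum /=; apply: eq_bigr => b _.
rewrite coef_neg_conj_rev coef_pos_conj_rev rmorphD !rmorphM /= !rmorph_nat addrC.
by [].
Qed.

End Shifts.

(** * Moments on the torus *)

Section BoundedBorel.
Context d (T : measurableType d) (R : realType).
Implicit Types (f g : T -> R[i]).

Definition real_bounded_borel (f : T -> R) : Prop :=
  measurable_fun setT f /\ exists M, forall x, `|f x| <= M.

Lemma real_bounded_integrable (m : {finite_measure set T -> \bar R}) (f : T -> R) :
  real_bounded_borel f -> m.-integrable setT (EFin \o f).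
Proof.
move=> [mf [M fM]]; apply: measurable_bounded_integrable => //.
  by rewrite ltey_eq fin_num_measure.
exists M; split; first by rewrite num_real.
by move=> x Mx y _ /=; rewrite (le_trans (fM y)) // ltW.
Qed.

(** Both Jordan parts are finite measures, so bounded Borel functions are integrable against each
    and additivity holds part by part. *)
Lemma charge_integralD (nu : {charge set T -> \bar R}) (f g : T -> R) :
  real_bounded_borel f -> real_bounded_borel g ->
  charge_integral nu (fun x => f x + g x) =
  charge_integral nu f + charge_integral nu g.
Proof.
move=> bf bg; rewrite /charge_integral.
rewrite !RintegralD //; try exact: real_bounded_integrable.
by rewrite opprD addrACA.
Qed.

Lemma charge_integralZ (nu : {charge set T -> \bar R}) (c : R) (f : T -> R) :
  real_bounded_borel f ->
  charge_integral nu (fun x => c * f x) = c * charge_integral nu f.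
Proof.
move=> bf; rewrite /charge_integral.
rewrite !RintegralZl //; try exact: real_bounded_integrable.
by rewrite mulrBr.
Qed.

Lemma bounded_borel_Re f : bounded_borel f ->
  real_bounded_borel (fun x => complex.Re (f x)).
Proof.
(* The bound [M] lies in [R[i]], where the order compares the real parts of numbers with equal
   imaginary parts; its real part is a real bound. *)
move=> [mr _ [M fM]]; split=> //; exists (complex.Re M) => x.
have : `|complex.Re (f x)|%:C%C <= M by apply: le_trans (fM x); exact: normc_ge_Re.
by rewrite lecE => /andP[].
Qed.

Lemma bounded_borel_Im f : bounded_borel f ->
  real_bounded_borel (fun x => complex.Im (f x)).
Proof.
move=> [_ mi [M fM]]; split=> //; exists (complex.Re M) => x.
have : `|complex.Im (f x)|%:C%C <= M.
  apply: le_trans (fM x); case: (f x) => a b; rewrite normc_def /= lecR -sqrtr_sqr.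
  by rewrite ler_wsqrtr // lerDr sqr_ge0.
by rewrite lecE => /andP[].
Qed.

Lemma real_bounded_borelZ (c : R) (f : T -> R) :
  real_bounded_borel f -> real_bounded_borel (fun x => c * f x).
Proof.
move=> [mf [M fM]]; split; first by apply: measurable_funM.
by exists (`|c| * M) => x; rewrite normrM ler_wpM2l.
Qed.

Lemma complex_integralD (mu : complex_measure T R) f g :
  bounded_borel f -> bounded_borel g ->
  complex_integral mu (fun x => f x + g x) =
  complex_integral mu f + complex_integral mu g.
Proof.
move=> bf bg; have rf := bounded_borel_Re bf; have rg := bounded_borel_Re bg.
have jf := bounded_borel_Im bf; have jg := bounded_borel_Im bg.
rewrite /complex_integral.
have -> : (fun x => complex.Re (f x + g x)) =
    (fun x => complex.Re (f x) + complex.Re (g x)).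
  by apply/funext => x; case: (f x) (g x) => ? ? [].
have -> : (fun x => complex.Im (f x + g x)) =
    (fun x => complex.Im (f x) + complex.Im (g x)).
  by apply/funext => x; case: (f x) (g x) => ? ? [].
rewrite !charge_integralD //; apply/eqP; rewrite eq_complex /=.
by apply/andP; split; apply/eqP; ring.
Qed.

Lemma complex_integralZ (mu : complex_measure T R) (c : R[i]) f :
  bounded_borel f ->
  complex_integral mu (fun x => c * f x) = c * complex_integral mu f.
Proof.
move=> bf; have rf := bounded_borel_Re bf; have jf := bounded_borel_Im bf.
rewrite /complex_integral; case: c => a b.
have -> : (fun x => complex.Re (Complex a b * f x)) =
    (fun x => a * complex.Re (f x) + (- b) * complex.Im (f x)).
  by apply/funext => x; case: (f x) => ? ?; rewrite mulNr.
have -> : (fun x => complex.Im (Complex a b * f x)) =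
    (fun x => a * complex.Im (f x) + b * complex.Re (f x)).
  by apply/funext => x; case: (f x) => ? ?.
rewrite !charge_integralD ?charge_integralZ //; try exact: real_bounded_borelZ.
by apply/eqP; rewrite eq_complex /=; apply/andP; split; apply/eqP; ring.
Qed.

Lemma bounded_borel_cst (c : R[i]) : bounded_borel (fun _ : T => c).
Proof. by split; [exact: measurable_cst | exact: measurable_cst | exists `|c|]. Qed.

Lemma bounded_borelD f g : bounded_borel f -> bounded_borel g ->
  bounded_borel (fun x => f x + g x).
Proof.
move=> [rf jf [M fM]] [rg jg [M' gM]]; split.
- have -> : (fun x => complex.Re (f x + g x)) =
    (fun x => complex.Re (f x) + complex.Re (g x)).
    by apply/funext => x; case: (f x) (g x) => ? ? [].
  exact: measurable_funD.
- have -> : (fun x => complex.Im (f x + g x)) =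
    (fun x => complex.Im (f x) + complex.Im (g x)).
    by apply/funext => x; case: (f x) (g x) => ? ? [].
  exact: measurable_funD.
- by exists (M + M') => x; apply: le_trans (ler_normD _ _) (lerD _ _).
Qed.

Lemma bounded_borelM f g : bounded_borel f -> bounded_borel g ->
  bounded_borel (fun x => f x * g x).
Proof.
move=> [rf jf [M fM]] [rg jg [M' gM]]; split.
- have -> : (fun x => complex.Re (f x * g x)) =
    (fun x => complex.Re (f x) * complex.Re (g x) - complex.Im (f x) * complex.Im (g x)).
    by apply/funext => x; case: (f x) (g x) => ? ? [].
  by apply: measurable_funB; apply: measurable_funM.
- have -> : (fun x => complex.Im (f x * g x)) =
    (fun x => complex.Re (f x) * complex.Im (g x) + complex.Im (f x) * complex.Re (g x)).
    by apply/funext => x; case: (f x) (g x) => ? ? [].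
  by apply: measurable_funD; apply: measurable_funM.
- by exists (M * M') => x; rewrite normrM ler_pM.
Qed.

Lemma bounded_borel_conj f : bounded_borel f -> bounded_borel (fun x => (f x)^*).
Proof.
move=> [rf jf [M fM]]; split.
- have -> : (fun x => complex.Re (f x)^*) = (fun x => complex.Re (f x)) => //.
  by apply/funext => x; case: (f x).
- have -> : (fun x => complex.Im (f x)^*) = (fun x => - complex.Im (f x)).
    by apply/funext => x; case: (f x).
  exact: measurableT_comp.
- by exists M => x; rewrite norm_conjC.
Qed.

Lemma bounded_borel_sum I (r : seq I) (F : I -> T -> R[i]) :
  (forall j, bounded_borel (F j)) -> bounded_borel (fun x => \sum_(j <- r) F j x).
Proof.
move=> bF; elim: r => [|j r IH].
  under eq_fun do rewrite big_nil; exact: bounded_borel_cst.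
by under eq_fun do rewrite big_cons; exact: bounded_borelD.
Qed.

Lemma bounded_borel_prod I (r : seq I) (F : I -> T -> R[i]) :
  (forall j, bounded_borel (F j)) -> bounded_borel (fun x => \prod_(j <- r) F j x).
Proof.
move=> bF; elim: r => [|j r IH].
  under eq_fun do rewrite big_nil; exact: bounded_borel_cst.
by under eq_fun do rewrite big_cons; exact: bounded_borelM.
Qed.

Lemma complex_integral_sum (mu : complex_measure T R) I (r : seq I)
    (F : I -> T -> R[i]) : (forall j, bounded_borel (F j)) ->
  complex_integral mu (fun x => \sum_(j <- r) F j x) =
  \sum_(j <- r) complex_integral mu (F j).
Proof.
move=> bF; elim: r => [|j r IH].
  (* Writing the zero integrand as a multiple of zero reduces the empty sum to homogeneity. *)
  under eq_fun do rewrite big_nil -(mul0r 0).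
  by rewrite complex_integralZ ?mul0r ?big_nil //; exact: bounded_borel_cst.
under eq_fun do rewrite big_cons.
by rewrite big_cons -IH complex_integralD //; exact: bounded_borel_sum.
Qed.

End BoundedBorel.

(** * Three-term relation and Toeplitz symmetry of the moments *)

Section TorusMoments.
Variables (R : realType) (D : nat).
Implicit Types (t : torus_borel R D) (a b : 'I_D) (al be : midx D).

Lemma norm_torus_coord t a : `|torus_coord t a| = 1.
Proof. by have := set_valP t; apply. Qed.

Lemma torus_coord_neq0 t a : torus_coord t a != 0.
Proof. by rewrite -normr_eq0 norm_torus_coord oner_eq0. Qed.

Lemma torus_coord_conj t a : (torus_coord t a)^* = (torus_coord t a)^-1.
Proof. by rewrite invC_norm norm_torus_coord expr1n invr1 mul1r. Qed.

(* [p] is 1-Lipschitz when it is additive and dominated by the norm. *)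
Lemma measurable_torus_part (p : R[i]^o -> R) a :
  {morph p : x y / x - y} -> (forall x, `|p x|%:C%C <= `|x|) ->
  measurable_fun setT (fun t => p (torus_coord t a)).
Proof.
move=> pB p_le.
have cp : continuous p.
  (* Balls of [R[i]] have radii in [R[i]], so the real radius is embedded. *)
  move=> x A /nbhs_ballP[e /= e0 eA]; apply/nbhs_ballP; exists e%:C%C.
    by rewrite /= ltcR.
  move=> y xy; apply: eA; rewrite /ball /= -pB -ltcR.
  exact: le_lt_trans (p_le _) xy.
have cf : continuous (fun t : (@torus R D : Type) => p (set_val t 0 a)).
  move=> t; apply: (@continuous_comp _ _ _ _ p); last exact: cp.
  apply: (@continuous_comp _ _ _ set_val (fun M : 'rV[R[i]^o]_D => M 0 a)).
    exact: initial_continuous.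
  exact: coord_continuous.
(* Open intervals generate the Borel sets of the line, and their preimages are open in the torus. *)
apply: (measurability _ (RGenOpens.measurableE R)) => _ [_ [u [v ->]] <-].
rewrite setTI; apply: sub_sigma_algebra.
by move/continuousP : cf; apply; exact: interval_open.
Qed.

Lemma bounded_borel_torus_coord a :
  bounded_borel (fun t : torus_borel R D => torus_coord t a).
Proof.
split.
- apply: (@measurable_torus_part (@complex.Re R)) => [[? ?] []//|x].
  exact: normc_ge_Re.
- apply: (@measurable_torus_part (@complex.Im R)) => [[? ?] []//|[u v]].
  by rewrite normc_def /= lecR -sqrtr_sqr ler_wsqrtr // lerDr sqr_ge0.
- by exists 1 => t; rewrite norm_torus_coord.
Qed.

Lemma bounded_borel_monomial al :
  bounded_borel (fun t : torus_borel R D => monomial (torus_coord t) al).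
Proof.
apply: bounded_borel_prod => a.
have bX (f : torus_borel R D -> R[i]) n : bounded_borel f ->
    bounded_borel (fun t => f t ^+ n).
  move=> bf; elim: n => [|n IH]; first exact: bounded_borel_cst.
  by under eq_fun do rewrite exprS; exact: bounded_borelM.
case: (tnth al a) => n.
  exact: bX (bounded_borel_torus_coord a).
(* On the torus the inverse of a coordinate is its conjugate, so negative powers are powers of a
   bounded Borel function. *)
under eq_fun do rewrite NegzE -exprz_inv -exprnP -torus_coord_conj.
apply: bX; apply: bounded_borel_conj; exact: bounded_borel_torus_coord.
Qed.

Definition moment (mu : complex_measure (torus_borel R D) R) al be : R[i] :=
  complex_integral mu (fun t =>
    monomial (torus_coord t) al * (monomial (torus_coord t) be)^*).

Lemma bounded_borel_moment al be : bounded_borel (fun t : torus_borel R D =>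
  monomial (torus_coord t) al * (monomial (torus_coord t) be)^*).
Proof.
by apply: bounded_borelM; last apply: bounded_borel_conj;
  exact: bounded_borel_monomial.
Qed.

(** Multiplying by z_b or z_b^-1 shifts the exponent of the first monomial, so by linearity the
    density L_n - q becomes [three_term] in the first index. *)
Lemma moment_three_term (mu Tmu : complex_measure (torus_borel R D) R) n q al be :
  has_density Tmu (fun t => laurent1 n (torus_coord t) - q) mu ->
  moment Tmu al be = three_term n q ((moment mu)^~ be) al.
Proof.
move=> TmuE; rewrite /moment TmuE; last exact: bounded_borel_moment.
pose f ga t : R[i] := monomial (torus_coord t) ga * (monomial (torus_coord t) be)^*.
have bf ga (c : R[i]) : bounded_borel (fun t => c * f ga t).
  by apply: bounded_borelM; [exact: bounded_borel_cst | exact: bounded_borel_moment].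
transitivity (complex_integral mu (fun t => \sum_(b < D)
    (coef_neg n b * f (midx_shift b (-1) al) t + coef_pos n b * f (midx_shift b 1 al) t)
    + (- q) * f al t)).
  congr complex_integral; apply/funext => t.
  rewrite mulrDl mulr_suml; congr (_ + _); apply: eq_bigr => b _.
  rewrite /f !monomial_shift ?torus_coord_neq0 //.
  by rewrite mulrDl !mulrA.
have bs b : bounded_borel (fun t => coef_neg n b * f (midx_shift b (-1) al) t +
    coef_pos n b * f (midx_shift b 1 al) t) by exact: bounded_borelD.
rewrite complex_integralD //; last exact: bounded_borel_sum.
rewrite complex_integral_sum // complex_integralZ ?mulNr; last exact: bounded_borel_moment.
congr (_ - _); apply: eq_bigr => b _.
by rewrite complex_integralD // !complex_integralZ //; exact: bounded_borel_moment.
Qed.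

(** Conjugation inverts z_b on the torus, so a factor z_b^s on the first monomial equals the
    conjugate of z_b^-s on the second. *)
Lemma moment_toeplitz (mu : complex_measure (torus_borel R D) R) b s al be :
  moment mu (midx_shift b s al) be = moment mu al (midx_shift b (- s) be).
Proof.
congr complex_integral; apply/funext => t.
rewrite !monomial_shift ?torus_coord_neq0 // rmorphM /= rmorphXz; last first.
  by rewrite unitfE torus_coord_neq0.
by rewrite /= torus_coord_conj exprz_inv opprK mulrCA mulrA.
Qed.

(** The Toeplitz property carries the shifts of [be] over to [al] with opposite sign; this exchange
    and the conjugation of the coefficients produce [conj_rev n]. *)
Lemma moment_conj_three_term (mu Tmu : complex_measure (torus_borel R D) R) n q al be :
  has_density Tmu (fun t => laurent1 n (torus_coord t) - q) mu ->
  (moment Tmu be al)^* =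
    three_term (conj_rev n) q^* (fun ga => (moment mu be ga)^*) al.
Proof.
move=> TmuE; rewrite (moment_three_term _ _ TmuE) /three_term rmorphB rmorphM rmorph_sum /=.
congr (_ - _); apply: eq_bigr => b _.
rewrite rmorphD !rmorphM /= !moment_toeplitz opprK.
by rewrite coef_neg_conj_rev coef_pos_conj_rev addrC.
Qed.

End TorusMoments.

(** * The recursion *)

Lemma laurent_poly0 (R : realType) D (S : semi_inf R D) w :
  lower_unitriangular S -> laurent_poly S 0 w = const_mx 1.
Proof.
move=> [S1 _]; rewrite /laurent_poly big_ord1 S1 mul1mx.
apply/matrixP => r s; rewrite !mxE /monomial big1 // => a _.
suff -> : tnth (lidx r) a = 0 by rewrite expr0z.
apply/eqP; rewrite -absz_eq0 -leqn0.
by apply: leq_trans (eq_leq (mdeg_lidx r)); rewrite /mdeg (bigD1 a) //= leq_addr.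
Qed.

Lemma mulmx_product_column (R : realType) D
    (F : forall k, 'M[R[i]]_(lsize D k.+1, lsize D k)) k :
  product_column F k.+1 = F k *m product_column F k.
Proof.
(* The size of block 0 is generalized to a variable so that the cast can be eliminated. *)
rewrite /product_column /=; move: (lsize0 D) (descending_product F k).
by move: (lsize D 0) => m e; case: _ / e => A; rewrite !castmx_id.
Qed.

Lemma product_column0 (R : realType) D
    (F : forall k, 'M[R[i]]_(lsize D k.+1, lsize D k)) :
  product_column F 0 = const_mx 1.
Proof.
rewrite /product_column /=; apply/matrixP => r s; rewrite castmxE !mxE ord1.
suff -> : cast_ord (esym (erefl (lsize D 0))) r = cast_ord (esym (lsize0 D)) 0 by rewrite eqxx.
by apply: val_inj; case: r => r /=; rewrite lsize0 ltnS leqn0 => /eqP.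
Qed.

Lemma plus_inverseK (R : realType) m n p (A : 'M[R[i]]_(m, n)) (B : 'M[R[i]]_(n, p)) :
  gram A \in unitmx -> plus_inverse A *m (A *m B) = B.
Proof. by move=> uA; rewrite /plus_inverse mulmxA -(mulmxA _ A^T A) mulVmx // mul1mx. Qed.

(** The blocks [K] stay abstract so that one induction serves both [nu] and [nu_hat]. *)
Lemma product_column_recursion (R : realType) D
    (K : 'I_(D + D) -> forall k, 'M[R[i]]_(lsize D k, lsize D k.+1))
    (TH : 'I_(D + D) -> forall k, 'M[R[i]]_(lsize D k))
    (H : forall k, 'M[R[i]]_(lsize D k)) (X : forall k, 'cV[R[i]]_(lsize D k)) k :
  X 0%N = const_mx 1 ->
  (forall a j, K a j *m X j.+1 = - (TH a j *m invmx (H j) *m X j)) ->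
  (forall j, (j < k)%N -> gram (\mxcol_(a < D + D) K a j) \in unitmx) ->
  X k = (-1) ^+ k *: product_column (fun j =>
    plus_inverse (\mxcol_(a < D + D) K a j) *m THstack TH j *m invmx (H j)) k.
Proof.
move=> X0 KX; elim: k => [|k IH] uK; first by rewrite X0 product_column0 expr0 scale1r.
rewrite mulmx_product_column exprS mulN1r scaleNr scalemxAr -IH; last first.
  by move=> j jk; apply: uK; rewrite ltnW.
(* The left inverse recovers [X k.+1] from the stacked vector, whose blocks [KX] expresses through
   [X k]. *)
rewrite -[LHS](plus_inverseK _ (uK k (ltnSn k))) mxcol_mul -!mulmxA -2!mulmxN.
congr (_ *m (_ *m _)); rewrite /THstack !mxcol_mul -mxcolN; apply: eq_mxcol => a.
by rewrite KX mulmxA.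
Qed.

Theorem theorem4p1 (R : realType) (D : nat) (D_ge1 : (1 <= D)%N)
    (mu : complex_measure (torus_borel R D) R)
    (mu_qd : quasi_definite mu)
    (N : 'M[R[i]]_(D + D)) (N_free : row_free N)
    (z : 'I_D -> R[i]) (z_neq0 : forall b, z b != 0)
    (q : 'I_(D + D) -> R[i]) (qE : forall a, q a = laurent1 (row a N) z)
    (Tmu : 'I_(D + D) -> complex_measure (torus_borel R D) R)
    (TmuE : forall a, has_density (Tmu a)
       (fun t => laurent1 (row a N) (torus_coord t) - q a) mu)
    (Tmu_qd : forall a, quasi_definite (Tmu a))
    (Smat Shat : semi_inf R D) (H : forall k, 'M[R[i]]_(lsize D k))
    (GE : gauss_factorization (moment_matrix mu) Smat H Shat)
    (TSmat TShat : 'I_(D + D) -> semi_inf R D)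
    (TH : 'I_(D + D) -> forall k, 'M[R[i]]_(lsize D k))
    (TGE : forall a,
       gauss_factorization (moment_matrix (Tmu a)) (TSmat a) (TH a) (TShat a))
    (k : nat) :
  ((forall j, (j < k)%N -> gram (Nstack N j) \in unitmx) ->
   laurent_poly Smat k z =
     (-1) ^+ k *: product_column (fun j =>
       plus_inverse (Nstack N j) *m THstack TH j *m invmx (H j)) k)
  /\
  ((forall j, (j < k)%N -> gram (Nstack_hat N j) \in unitmx) ->
   laurent_poly Shat k (fun b => ((z b)^*)^-1) =
     (-1) ^+ k *: product_column (fun j =>
       plus_inverse (Nstack_hat N j)
         *m THstack (fun a => dagger_blocks (TH a)) j
         *m invmx (dagger_blocks H j)) k).
Proof.
have [Sl S'l _ _] := GE.
split=> uN.
  apply: (product_column_recursion (K := fun a k => nu (row a N) k k.+1)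
    (X := fun k => laurent_poly Smat k z)) => // [|a j].
    exact: laurent_poly0.
  apply: (nu_connection (M := moment mu) (TM := moment (Tmu a)) j _ z_neq0 (qE a) GE (TGE a)).
  by move=> al be; apply: moment_three_term.
(* At this point the Laurent polynomial with coefficients [conj_rev] takes the value conj q_a. *)
pose w b := ((z b)^*)^-1.
apply: (product_column_recursion (K := fun a k => nu_hat (row a N) k k.+1)
  (TH := fun a => dagger_blocks (TH a)) (H := dagger_blocks H)
  (X := fun k => laurent_poly Shat k w)) => // [|a j].
  exact: laurent_poly0.
have momentC (m : complex_measure (torus_borel R D) R) r s :
    dagger (moment_matrix m s r) = semi_inf_of (fun al be => (moment m be al)^*) r s.
  by apply/matrixP => u v; rewrite !mxE.
(* The adjoint moment matrix is put in the entrywise form that [nu_connection] takes, with the two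
   triangular factors interchanged. *)
have gaussC (m : complex_measure (torus_borel R D) R) S S' B :
    gauss_factorization (moment_matrix m) S B S' ->
    gauss_factorization (semi_inf_of (fun al be => (moment m be al)^*)) S'
      (dagger_blocks B) S.
  move=> /gauss_factorization_dagger [? ? ? [Si [Si' [? ? ? ? gE]]]].
  by split=> //; exists Si, Si'; split=> // *; rewrite -momentC gE.
rewrite nu_hatE.
apply: (nu_connection (q := (q a)^*) j _ _ _ (gaussC _ _ _ _ GE) (gaussC _ _ _ _ (TGE a))).
- by move=> al be; apply: moment_conj_three_term.
- by move=> b; rewrite invr_eq0 conjC_eq0.
- rewrite qE /laurent1 rmorph_sum; apply: eq_bigr => b _.
  rewrite rmorphD !rmorphM fmorphV coef_neg_conj_rev coef_pos_conj_rev /w invrK.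
  by rewrite addrC.
Qed.
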